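(* Let $(\mathfrak g,[\cdot,\cdot],\alpha,d)$ be a regular Hom-Lie algebra with an $\alpha$-derivation $d$. Then $(\mathfrak g,\alpha^{-1}\circ[\cdot,\cdot])$ is a Lie algebra, and $\alpha^{-1}\circ d$ is a derivation of this Lie algebra.
   Context: All vector spaces are over a fixed field $\mathbb{K}$ of characteristic $0$. A Hom-Lie algebra is a triple $(\mathfrak g,[\cdot,\cdot],\alpha)$ with $\mathfrak g$ a vector space, $[\cdot,\cdot]:\mathfrak g\times\mathfrak g\to\mathfrak g$ a skew-symmetric bilinear map and $\alpha:\mathfrak g\to\mathfrak g$ linear such that $[\alpha(x),[y,z]]+[\alpha(y),[z,x]]+[\alpha(z),[x,y]]=0$ and $\alpha([x,y])=[\alpha(x),\alpha(y)]$ for all $x,y,z\in\mathfrak g$. It is regular if $\alpha$ is bijective. An $\alpha$-derivation of it is a linear map $d:\mathfrak g\to\mathfrak g$ with $d\circ\alpha=\alpha\circ d$ and $d([x,y])=[d(x),\alpha(y)]+[\alpha(x),d(y)]$ for all $x,y\in\mathfrak g$. *)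

(* Defs.v *)
From mathcomp Require Import all_boot all_algebra.
Set Implicit Arguments.
Unset Strict Implicit.
Unset Printing Implicit Defensive.
Import GRing.Theory.
Local Open Scope ring_scope.

Section Inverse.
Variables (T : eqType) (U : choiceType).

Lemma bij_surj (f : U -> T) : bijective f -> forall y, exists x, f x == y.
Proof. by case=> h _ hK y; exists (h y); rewrite hK. Qed.

Definition bij_inv (f : U -> T) (bijf : bijective f) : T -> U :=
  fun y => xchoose (bij_surj bijf y).

Lemma bij_invKV (f : U -> T) (bijf : bijective f) : cancel (bij_inv bijf) f.
Proof. by move=> y; apply/eqP/(xchooseP (bij_surj bijf y)). Qed.

Lemma bij_invK (f : U -> T) (bijf : bijective f) : cancel f (bij_inv bijf).
Proof. by move=> x; apply: (bij_inj bijf); rewrite bij_invKV. Qed.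

End Inverse.

Section HomLie.
Variables (K : fieldType) (g : lmodType K).
Implicit Types (br : g -> g -> g) (alpha d : g -> g).

Definition skew_symmetric br := forall x y, br x y = - br y x.

Record is_hom_lie br alpha : Prop := IsHomLie {
  hom_lie_bilinear : bilinear_for *:%R *:%R br;
  hom_lie_skew : skew_symmetric br;
  hom_lie_linear : linear alpha;
  hom_lie_jacobi : forall x y z,
    br (alpha x) (br y z) + br (alpha y) (br z x) + br (alpha z) (br x y) = 0;
  hom_lie_mult : forall x y, alpha (br x y) = br (alpha x) (alpha y)
}.

Record is_alpha_derivation br alpha d : Prop := IsAlphaDerivation {
  alpha_der_linear : linear d;
  alpha_der_comm : d \o alpha =1 alpha \o d;
  alpha_der_leibniz : forall x y,
    d (br x y) = br (d x) (alpha y) + br (alpha x) (d y)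
}.

(* Skew-symmetry is equivalent to [br x x = 0] when 2 is invertible in K, in
   particular in characteristic 0. *)
Record is_lie br : Prop := IsLie {
  lie_bilinear : bilinear_for *:%R *:%R br;
  lie_skew : skew_symmetric br;
  lie_jacobi : forall x y z,
    br x (br y z) + br y (br z x) + br z (br x y) = 0
}.

Record is_derivation br d : Prop := IsDerivation {
  der_linear : linear d;
  der_leibniz : forall x y, d (br x y) = br (d x) y + br x (d y)
}.

End HomLie.

(* Main.v *)
Require Import Defs.
From HB Require Import structures.
From mathcomp Require Import all_boot all_algebra.
Set Implicit Arguments.
Unset Strict Implicit.
Unset Printing Implicit Defensive.
Import GRing.Theory.
Local Open Scope ring_scope.

(** The inverse [alphaV] is again linear, so [brV] stays bilinear and skew. As [alpha] is
    multiplicative, [alpha] squared sends [brV x (brV y z)] to [br (alpha x) (br y z)]; since it is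
    injective, Jacobi for [brV] reduces to Hom-Jacobi, and Leibniz for [alphaV \o d] to that of
    [d]. *)

Theorem proposition4p1 (K : fieldType) (charK0 : [pchar K] =i pred0)
    (g : lmodType K) (br : g -> g -> g) (alpha d : g -> g)
    (hom_lie_g : is_hom_lie br alpha) (bij_alpha : bijective alpha)
    (der_d : is_alpha_derivation br alpha d) :
  let alphaV : g -> g := bij_inv bij_alpha in
  let brV : g -> g -> g := fun x y => alphaV (br x y) in
  is_lie brV /\ is_derivation brV (alphaV \o d).
Proof.
move=> alphaV brV.
have alphaK : cancel alpha alphaV by apply: bij_invK.
have alphaVK : cancel alphaV alpha by apply: bij_invKV.
have alpha_inj := bij_inj bij_alpha.
case: hom_lie_g => [[br_linl br_linr] br_skew alpha_lin br_jacobi alphaM].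
case: der_d => d_lin d_alpha d_br.
(* Bundling [alpha] makes [can2_linear] and the [raddf] lemmas applicable. *)
pose alphaL : {linear g -> g} :=
  HB.pack alpha (GRing.isLinear.Build K g g *:%R alpha alpha_lin).
have alphaV_lin : linear alphaV := @can2_linear _ _ _ alphaL alphaV alphaK alphaVK.
pose alphaVL : {linear g -> g} :=
  HB.pack alphaV (GRing.isLinear.Build K g g *:%R alphaV alphaV_lin).
have alphaD : {morph alpha : x y / x + y} := raddfD alphaL.
have alpha0 : alpha 0 = 0 := raddf0 alphaL.
split; split.
- by split=> z c x y; rewrite /brV /= ?br_linl ?br_linr alphaV_lin.
- by move=> x y; rewrite /brV br_skew; exact: (raddfN alphaVL).
(* Applying alpha twice turns the Jacobi identity into the Hom-Jacobi one. *)
- move=> x y z; apply/alpha_inj/alpha_inj.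
  by rewrite /brV !alphaD !alphaVK !alphaM !alphaVK br_jacobi !alpha0.
- by move=> c x y; rewrite /= d_lin alphaV_lin.
(* Applying alpha twice turns the Leibniz rule into the one for d. *)
- move=> x y; apply/alpha_inj/alpha_inj.
  (* Moving [alpha] inside [d] lets it cancel the [alphaV] of [brV x y]. *)
  have d_alphaE u : alpha (d u) = d (alpha u) by exact: esym (d_alpha u).
  by rewrite /brV /= !alphaD !alphaVK !alphaM !alphaVK d_alphaE alphaVK d_br.
Qed.
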